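(* For integers $i\ge0$, $j\ge0$: (a) for every real $k$, $\sum_{r=j}^{i}c_{i,r,k}\,b_{r,j,k}=j!\,\delta_{i,j}$; (b) for integers $k_1,k_2$ with $k_2\ge k_1$, $\sum_{r=j}^{i}c_{i,r,k_1}\,b_{r,j,k_2}=i!\binom{k_2-k_1}{i-j}$.
   Context: The signed Stirling numbers of the first kind $s_{i,r}$ are defined by $x(x-1)\cdots(x-i+1)=\sum_{r=0}^{i}s_{i,r}x^r$. For integers $i,j\ge0$ and real $k$, $c_{i,j,k}=\sum_{r=j}^{i}\binom{r}{j}(-k)^{r-j}s_{i,r}$ (zero if $j>i$), and the moment generating Stirling numbers of the second kind are $b_{i,j,k}=\sum_{r=0}^{j}\binom{j}{r}(-1)^{j-r}(r+k)^i$ (with $0^0=1$). $\delta_{i,j}$ is the Kronecker delta, and $\binom{n}{m}=0$ for $m<0$ or $m>n$ (nonnegative integer $n$). An empty sum (when $j>i$) is $0$. *)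

(* Defs.v *)
From mathcomp Require Import all_boot all_order all_algebra.
From mathcomp Require Import reals.

Set Implicit Arguments.
Unset Strict Implicit.
Unset Printing Implicit Defensive.

Import Order.TTheory GRing.Theory Num.Theory.

Local Open Scope ring_scope.

(* s_{i,r}: the coefficient of x^r in x(x-1)...(x-i+1). *)
Definition stirling1 (i r : nat) : int :=
  (\prod_(l < i) ('X - (l%:R)%:P) : {poly int})`_r.

(* c_{i,j,k}; the sum is empty, hence zero, when j > i. *)
Definition cstirl (R : realType) (i j : nat) (k : R) : R :=
  \sum_(j <= r < i.+1)
    'C(r, j)%:R * (- k) ^+ (r - j) * (stirling1 i r)%:~R.

(* b_{i,j,k}; x ^+ 0 = 1 for every x, which includes 0^0 = 1. *)
Definition bstirl (R : realType) (i j : nat) (k : R) : R :=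
  \sum_(0 <= r < j.+1) 'C(j, r)%:R * (-1) ^+ (j - r) * (r%:R + k) ^+ i.

(* The lower index is an integer, because natural-number subtraction would
   turn a negative one into 0 and the binomial coefficient into 1. *)
Definition binz (n : nat) (m : int) : nat :=
  if m is Posz m' then 'C(n, m') else 0%N.

(* Main.v *)
Require Import Defs.
From mathcomp Require Import all_boot all_order all_algebra.
From mathcomp Require Import reals.
From mathcomp Require Import ring zify.

(** The numbers [c_(i,r,k)] are the coefficients of the falling factorial
    [(x - k)(x - k - 1)...(x - k - i + 1)], and [b_(r,j,k)] is the [j]-th forward
    difference of [x ^ r] at [x = k].  Since that difference vanishes for
    [r < j], the sum of [c_(i,r,k1) b_(r,j,k2)] is the [j]-th difference of the
    falling factorial of length [i] at [k2 - k1].  As [i! C(x, i)] has [j]-th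
    difference [i! C(x, i - j)], both parts follow; (a) is the case
    [k2 - k1 = 0]. *)

Import Order.TTheory GRing.Theory Num.Theory.

Local Open Scope ring_scope.

(** The [j]-th forward difference of [f] at 0. *)
Definition fdiff {R : pzRingType} (j : nat) (f : nat -> R) : R :=
  \sum_(r < j.+1) 'C(j, r)%:R * (-1) ^+ (j - r) * f r.

(** Pascal's rule on ['C(j.+1, r.+1)] splits the sum into one over [f r.+1] and one over [f r]. *)
Lemma fdiffS (R : comPzRingType) j (f : nat -> R) :
  fdiff j.+1 f = fdiff j (fun r => f r.+1 - f r).
Proof.
rewrite /fdiff.
under [RHS]eq_bigr do rewrite mulrBr.
rewrite sumrB big_ord_recl [X in _ = _ - X]big_ord_recl.
under eq_bigr => r _ do
  rewrite lift0 binS natrD subSS 2!mulrDl.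
rewrite big_split /= addrA addrC; congr (_ + _).
rewrite !bin0 !subn0 exprS opprD; congr (_ + _); first by ring.
rewrite big_ord_recr /= bin_small // mul0r mul0r addr0 -sumrN.
apply: eq_bigr => r _; rewrite /bump add1n.
by rewrite -(subnSK (ltn_ord r)) exprS; ring.
Qed.

(** One difference turns a power into a combination of strictly lower powers, so induction on [j]
    applies to each of them. *)
Lemma fdiff_exp_eq0 (R : comPzRingType) j n (x : R) :
  (n < j)%N -> fdiff j (fun r => (r%:R + x) ^+ n) = 0.
Proof.
elim: j n => // j IHj n n_le_j; rewrite fdiffS.
have difE r : (r.+1%:R + x) ^+ n - (r%:R + x) ^+ n
    = \sum_(k < n) (r%:R + x) ^+ k *+ 'C(n, k).
  rewrite -natr1 addrAC (addrC _ 1) exprDn big_ord_recr /=.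
  rewrite subnn expr0 mul1r binn mulr1n addrK.
  by apply: eq_bigr => k _; rewrite expr1n mul1r.
rewrite /fdiff; under eq_bigr do rewrite difE mulr_sumr.
rewrite exchange_big big1 // => k _.
under eq_bigr do rewrite mulrnAr.
by rewrite sumrMnl [X in X *+ _]IHj ?mul0rn //; have := ltn_ord k; lia.
Qed.

(** By Pascal's rule each difference lowers the bottom index by one. *)
Lemma fdiff_bin (R : comPzRingType) d i j :
  fdiff j (fun r => 'C(d + r, j + i)%:R) = 'C(d, i)%:R :> R.
Proof.
elim: j => [|j IHj].
  by rewrite /fdiff big_ord1 bin0 !mul1r addn0 add0n.
rewrite fdiffS -IHj /fdiff; apply: eq_bigr => r _.
by rewrite addnS addSn binS natrD addrAC subrr add0r.
Qed.

Lemma prod_subr_ffact (R : comPzRingType) n i :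
  \prod_(l < i) (n%:R - l%:R) = (n ^_ i)%:R :> R.
Proof.
elim: i => [|i IHi]; first by rewrite big_ord0 ffactn0.
rewrite big_ord_recr /= IHi ffactnSr natrM.
(* Truncated [n - i] disagrees with the ring subtraction only for [n < i], where [n ^_ i] is already
   0. *)
have [le_in|lt_ni] := leqP i n; first by rewrite natrB.
by rewrite ffact_small // !mul0r.
Qed.

Lemma stirling1_sum (R : comNzRingType) i (x : R) :
  \sum_(s < i.+1) (stirling1 i s)%:~R * x ^+ s = \prod_(l < i) (x - l%:R).
Proof.
pose p : {poly int} := \prod_(l < i) ('X - (l%:R)%:P).
(* The image of [p] is still a product of [i] monic linear factors, so evaluation sums exactly
   [i.+1] coefficients. *)
have sz_p : size (map_poly intr p : {poly R}) = i.+1.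
  rewrite rmorph_prod /=; under eq_bigr do rewrite map_polyXsubC.
  by rewrite size_prod_XsubC /index_enum -enumT size_enum_ord.
transitivity (map_poly intr p).[x].
  by rewrite horner_coef sz_p; apply: eq_bigr => s _; rewrite coef_map.
rewrite rmorph_prod horner_prod; apply: eq_bigr => l _ /=.
by rewrite map_polyXsubC hornerXsubC rmorph_nat.
Qed.

(** Expand each power of [x - k] in [stirling1_sum] by the binomial theorem and collect the powers
    of [x]. *)
Lemma cstirl_sum (R : realType) i (k x : R) :
  \sum_(r < i.+1) cstirl i r k * x ^+ r = \prod_(l < i) (x - k - l%:R).
Proof.
rewrite -stirling1_sum.
(* Terms with [s < r] have ['C(s, r) = 0]; adding them makes the double sum rectangular, so it can
   be exchanged. *)
have cE (r : 'I_i.+1) : cstirl i r k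
    = \sum_(s < i.+1) 'C(s, r)%:R * (- k) ^+ (s - r) * (stirling1 i s)%:~R.
  rewrite /cstirl -(big_mkord xpredT (fun s =>
    'C(s, r)%:R * (- k) ^+ (s - r) * (stirling1 i s)%:~R)).
  rewrite [RHS](big_cat_nat _ (n := r)) //=; last exact: ltnW.
  rewrite [X in _ = X + _]big1_seq ?add0r //= => s.
  rewrite mem_index_iota => /andP[_ lt_sr].
  by rewrite bin_small // !mul0r.
under eq_bigr do rewrite cE mulr_suml.
rewrite exchange_big; apply: eq_bigr => s _ /=.
rewrite (addrC x) exprDn mulr_sumr.
rewrite (big_ord_widen i.+1 (fun r => (stirling1 i s)%:~R *
  ((- k) ^+ (s - r) * x ^+ r *+ 'C(s, r)))) //.
rewrite [RHS]big_mkcond; apply: eq_bigr => r _ /=.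
rewrite ltnS -mulr_natr; case: leqP => [_|lt_sr]; first by ring.
by rewrite bin_small // !(mul0r, mulr0).
Qed.

Lemma bstirlE (R : realType) i j (k : R) :
  bstirl i j k = fdiff j (fun r => (r%:R + k) ^+ i).
Proof. by rewrite /bstirl big_mkord. Qed.

Lemma sum_cstirl_bstirl (R : realType) i j (k1 k2 : R) :
  (j <= i)%N ->
  \sum_(j <= r < i.+1) cstirl i r k1 * bstirl r j k2
  = fdiff j (fun n => \prod_(l < i) (n%:R + k2 - k1 - l%:R)).
Proof.
move=> le_ji.
(* The terms with [r < j] can be added because [bstirl r j k2] vanishes there; [cstirl_sum] needs
   the full range. *)
transitivity (\sum_(r < i.+1) cstirl i r k1 * bstirl r j k2).
  rewrite -(big_mkord xpredT (fun r => cstirl i r k1 * bstirl r j k2)).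
  rewrite [RHS](big_cat_nat _ (n := j)) //=; last exact: leqW.
  rewrite [X in _ = X + _]big1_seq ?add0r //= => r.
  rewrite mem_index_iota => /andP[_ lt_rj].
  by rewrite bstirlE fdiff_exp_eq0 ?mulr0.
rewrite /fdiff; under [RHS]eq_bigr do rewrite -cstirl_sum mulr_sumr.
rewrite exchange_big; apply: eq_bigr => r _ /=.
rewrite bstirlE mulr_sumr; apply: eq_bigr => n _; exact: mulrCA.
Qed.

Lemma sum_cstirl_bstirl_bin (R : realType) i j d (k1 k2 : R) :
  k2 - k1 = d%:R -> (j <= i)%N ->
  \sum_(j <= r < i.+1) cstirl i r k1 * bstirl r j k2
  = i`!%:R * 'C(d, i - j)%:R.
Proof.
move=> dE le_ji; rewrite sum_cstirl_bstirl // -(fdiff_bin R d (i - j) j).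
rewrite subnKC // /fdiff mulr_sumr; apply: eq_bigr => n _.
(* The product is the falling factorial of [d + n], that is [i!] times ['C(d + n, i)]. *)
rewrite -addrA dE -natrD prod_subr_ffact addnC -bin_ffact natrM; ring.
Qed.

Theorem theorem2p10 (R : realType) (i j : nat) :
  (forall k : R,
     \sum_(j <= r < i.+1) cstirl i r k * bstirl r j k
     = j`!%:R * (i == j)%:R) /\
  (forall k1 k2 : int, k1 <= k2 ->
     \sum_(j <= r < i.+1) cstirl i r (k1%:~R : R) * bstirl r j (k2%:~R : R)
     = i`!%:R * (binz `|k2 - k1|%N (i%:Z - j%:Z))%:R).
Proof.
have [le_ji|lt_ij] := leqP j i; last first.
  split=> [k|k1 k2 _]; rewrite big_geq //.
    by rewrite ltn_eqF // mulr0.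
  (* Here [i - j] is negative, so only the zero branch of [binz] can occur. *)
  case def_m: (i%:Z - j%:Z) => [m|m] /=; [lia | by rewrite mulr0].
split=> [k|k1 k2 le_k12].
  rewrite (@sum_cstirl_bstirl_bin R i j 0) ?subrr // bin0n subn_eq0.
  rewrite eqn_leq le_ji andbT; case: leqP => [le_ij|_]; last by rewrite !mulr0.
  by rewrite (@anti_leq i j) // le_ij.
rewrite subzn //= (@sum_cstirl_bstirl_bin R i j `|k2 - k1|%N) //.
by rewrite -rmorphB /= pmulrn gez0_abs ?subr_ge0.
Qed.
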